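(* For $f \in L(X^o)$ and $g_1, g_2 \in L(\partial X)$, the problem to find $u\in L(X)$ such that $$\Delta^2 u = f \ \text{ on } X^o,\quad \partial_{\vec n}u = g_1\ \text{ on }\partial X \quad\text{and}\quad u = g_2\ \text{ on }\partial X$$ admits a solution if and only if $$\Delta_{\partial X}\, g_2 + P_{\partial X, X^o} G_{X^o}^{\,2} f = -(I_{\partial X} + R)g_1 .$$ In this case, the solution is given by $$u = G_{X^o}^{\,2} f + G_{X^o} h_1 + h_2, \quad \text{where}\quad h_i(x) = \int_{\partial X} g_i\,d\nu_x \quad (x \in X,\ i=1,2).$$ Equivalently, for any choice of $z \in \partial X$, $$u= G_{X \setminus \{z\}}G_{X^o}f + G_{X \setminus \{z\}} h_1 + g_2(z).$$
   Context: Let $(X,E)$ be a finite directed graph with $|X|\ge 2$, $E\subset X^2$ without loops, which is strongly connected. Each edge $(x,y)\in E$ carries a weight $a(x,y)>0$, and $a(x,y)=0$ if $(x,y)\notin E$. Put $m(x)=\sum_y a(x,y)$, $p(x,y)=a(x,y)/m(x)$, $P=(p(x,y))_{x,y\in X}$. $L(B)$ is the space of functions $B\to\mathbb{C}$ (column vectors), $Pu(x)=\sum_y p(x,y)u(y)$, and $\Delta=P-I$. The boundary $\partial X$ is an arbitrary non-empty subset of $X$, and $X^o=X\setminus\partial X$. The outer normal derivative is $\partial_{\vec n}u(x)=-\Delta u(x)$ for $x\in\partial X$. For $A,B\subset X$, $P_{A,B}=(p(x,y))_{x\in A,y\in B}$ and $P_A=P_{A,A}$. For $A\subsetneq X$,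 $G_A=(I_A-P_A)^{-1}=\sum_{n\ge0}P_A^n$ (the inverse exists and the series converges); $G_A$ is also viewed as a matrix over $X\times X$ with entries $0$ outside $A\times A$. For $x\in X^o$ and $y\in\partial X$, $\nu_x(y)$ is the $(x,y)$-entry of $G_{X^o}P_{X^o,\partial X}$; for $x\in\partial X$, $\nu_x=\delta_x$; and $\int_{\partial X}g\,d\nu_x=\sum_{y\in\partial X}g(y)\nu_x(y)$. The boundary Markov chain has transition matrix $Q=P_{\partial X}+P_{\partial X,X^o}G_{X^o}P_{X^o,\partial X}$ over $\partial X$ (its entry $q(x,y)$ is the probability that the Markov chain with transition matrix $P$ started at $x\in\partial X$ is at $y$ at its first visit to $\partial X$ at a time $\ge1$), and the boundary Laplacian is $\Delta_{\partial X}=Q-I_{\partial X}$. Finally $R=P_{\partial X,X^o}\,G_{X^o}^{\,2}\,P_{X^o,\partial X}$, a matrix over $\partial X$. *)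

(* Defs.v *)
From HB Require Import structures.
From mathcomp Require Import all_boot all_order all_algebra.
From mathcomp Require Import reals complex.
Set Implicit Arguments.
Unset Strict Implicit.
Unset Printing Implicit Defensive.
Import Order.TTheory GRing.Theory Num.Theory.
Local Open Scope ring_scope.
Local Open Scope complex_scope.

(* Conventions. Functions on the whole vertex set X are plain functions
   X -> R[i]. For a subset A of X, the space L(A) is 'cV[R[i]]_#|A| and the
   matrices over A x B are 'M[R[i]]_(#|A|, #|B|): position i stands for the
   vertex enum_val i. *)

Section Network.
Variables (R : realType) (X : finType).

(* [ext g] and [entry M] read a vector, resp. a matrix, at vertices; they
   vanish outside A, resp. outside A x B. As enum_val is injective, the sums
   have at most one term. *)
Definition ext (A : {set X}) (g : 'cV[R[i]]_#|A|) (x : X) : R[i] :=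
  \sum_(i | enum_val i == x) g i 0.

Definition entry (A B : {set X}) (M : 'M[R[i]]_(#|A|, #|B|)) (x y : X) : R[i] :=
  \sum_(i | enum_val i == x) \sum_(j | enum_val j == y) M i j.

Definition act (K : X -> X -> R[i]) (u : X -> R[i]) (x : X) : R[i] :=
  \sum_y K x y * u y.

Variable a : X -> X -> R.

Definition mass (x : X) : R := \sum_y a x y.

Definition prob (x y : X) : R[i] := (a x y / mass x)%:C.

Definition laplacian (u : X -> R[i]) (x : X) : R[i] := act prob u x - u x.

Definition normal_deriv (u : X -> R[i]) (x : X) : R[i] := - laplacian u x.

Definition Pmx (A B : {set X}) : 'M[R[i]]_(#|A|, #|B|) :=
  \matrix_(i, j) prob (enum_val i) (enum_val j).

(* Only meaningful for A a proper subset of X, where I_A - P_A is invertible. *)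
Definition green (A : {set X}) : 'M[R[i]]_#|A| := invmx (1%:M - Pmx A A).

Variable dX : {set X}.

Definition nu (x y : X) : R[i] :=
  if x \in dX then (x == y)%:R
  else entry (green (~: dX) *m Pmx (~: dX) dX) x y.

Definition boundary_int (g : 'cV[R[i]]_#|dX|) (x : X) : R[i] :=
  \sum_(y in dX) ext g y * nu x y.

Definition boundaryQ : 'M[R[i]]_#|dX| :=
  Pmx dX dX + Pmx dX (~: dX) *m green (~: dX) *m Pmx (~: dX) dX.

Definition boundary_laplacian : 'M[R[i]]_#|dX| := boundaryQ - 1%:M.

Definition boundaryR : 'M[R[i]]_#|dX| :=
  Pmx dX (~: dX) *m green (~: dX) ^+ 2 *m Pmx (~: dX) dX.

Definition plate_solution (f : 'cV[R[i]]_#|~: dX|) (g1 g2 : 'cV[R[i]]_#|dX|)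
    (u : X -> R[i]) : Prop :=
  [/\ forall x, x \in ~: dX -> laplacian (laplacian u) x = ext f x,
      forall x, x \in dX -> normal_deriv u x = ext g1 x
    & forall x, x \in dX -> u x = ext g2 x].

End Network.

(* Main.v *)
Require Import Defs.
From HB Require Import structures.
From mathcomp Require Import all_boot all_order all_algebra.
From mathcomp Require Import reals complex.
Set Implicit Arguments.
Unset Strict Implicit.
Unset Printing Implicit Defensive.
Import Order.TTheory GRing.Theory Num.Theory.
Local Open Scope ring_scope.
Local Open Scope complex_scope.

(** Write G for the Green operator of the interior. The fourth-order problem is
a composition of two Dirichlet problems. If u solves it, then v = Laplacian of u
satisfies Laplacian of v = f inside and v = - g1 on the boundary; a Dirichlet
problem has only one solution, so v = - (G f + h1) everywhere. Hence the plate
problem is equivalent to a single Poisson equation on all of X, boundary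
included, with right-hand side - (G f + h1), together with u = g2 on the
boundary ([plate_solution_poisson]).

The Poisson equation in the interior and the boundary values already force
u = G (G f + h1) + h2. What remains is the Poisson equation on the boundary,
where G f + h1 reduces to g1; computing the Laplacian of the explicit u there
turns it into the compatibility condition ([compatibleP], [plate_solutionP]).
The second formula comes from the same global Poisson equation, solved as a
Dirichlet problem whose boundary is the single vertex z, with boundary value
u z = g2 z ([plate_solution_pinned]).

Everything rests on the uniqueness for the Dirichlet problem on a proper subset
A, a maximum principle ([harmonic_eq0], [dirichlet_unique]). Uniqueness also
gives the invertibility of I - P_A ([unitmx_green]), so that the Green operator
of A does solve the Poisson equation on A ([laplacian_green]). Functions on X
are thus the working objects, and matrices are translated into operators on
them by [restrict] and [act_entry]. *)

(** * Maximum principle *)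

(** At a maximum point of the modulus lying in A, the mean value property forces
the modulus to be maximal at all out-neighbours too. Following edges, the
maximum is attained at z, where it is zero. *)
Lemma harmonic_eq0 (C : numFieldType) (X : finType) (E : rel X)
    (p : X -> X -> C) (A : {set X}) (z : X) (u : X -> C)
    (strong : forall x y, connect E x y)
    (p_ge0 : forall x y, 0 <= p x y) (p_gt0 : forall x y, E x y -> 0 < p x y)
    (p_sum : forall x, \sum_y p x y = 1) (zA : z \notin A)
    (u_harm : forall x, x \in A -> u x = \sum_y p x y * u y)
    (u_out : forall x, x \notin A -> u x = 0) (x : X) : u x = 0.
Proof.
have [x0 _ x0_max] : extremum_spec >=%R predT (fun y => `|u y|)
    [arg max_(y > z) `|u y|]%O.
  by apply: real_arg_maxP => // y _; apply: normr_real.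
set M := `|u x0|.
have max0 y : `|u y| <= M by apply: x0_max.
suff spread y : connect E x0 y -> `|u y| = M.
  have M0 : M = 0 by rewrite -(spread z) // u_out // normr0.
  by apply/eqP; rewrite -normr_le0 -M0 max0.
(* The maximum propagates along a path from x0, by induction on its length. *)
case/connectP => s; elim/last_ind: s y => [|s w IH] y; first by move=> _ ->.
rewrite rcons_path last_rcons => /andP[/IH/(_ erefl)]; set v := last x0 s.
move=> uvM Evw ->; have [vA|vA] := boolP (v \in A); last first.
  move: uvM; rewrite u_out // normr0 => M0; apply/eqP.
  by rewrite eq_le max0 // -M0 normr_ge0.
(* The weighted sum of the gaps to the maximum has nonnegative terms and is
   nonpositive, hence all the gaps on edges leaving v vanish. *)
have terms_ge0 t : true -> 0 <= p v t * (M - `|u t|).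
  by move=> _; rewrite mulr_ge0 // subr_ge0 max0.
have sum_le0 : \sum_t p v t * (M - `|u t|) <= 0.
  under eq_bigr do rewrite mulrBr.
  rewrite sumrB -mulr_suml p_sum mul1r subr_le0 -uvM (u_harm _ vA).
  apply: (le_trans (ler_norm_sum _ _ _)); apply: ler_sum => t _.
  by rewrite normrM (ger0_norm (p_ge0 _ _)).
have sum0 : \sum_t p v t * (M - `|u t|) = 0.
  by apply/eqP; rewrite eq_le sum_le0 sumr_ge0.
have /eqP := psumr_eq0P terms_ge0 sum0 (i := w) isT.
by rewrite mulf_eq0 (gt_eqF (p_gt0 _ _ Evw)) /= subr_eq0 => /eqP.
Qed.

(** * Functions on vertices and matrices *)

Section Operators.
Variables (R : realType) (X : finType).
Implicit Types (A B D : {set X}) (K : X -> X -> R[i]) (u w : X -> R[i]).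

Definition restrict A w : 'cV[R[i]]_#|A| := \col_i w (enum_val i).

Lemma ext_enum_val A (g : 'cV[R[i]]_#|A|) i : ext g (enum_val i) = g i 0.
Proof.
rewrite /ext (eq_bigl (pred1 i)) ?big_pred1_eq // => j.
by rewrite /= (inj_eq enum_val_inj).
Qed.

Lemma ext_out A (g : 'cV[R[i]]_#|A|) x : x \notin A -> ext g x = 0.
Proof.
move=> xA; rewrite /ext big_pred0 // => i; apply: contraNF xA => /eqP <-.
exact: enum_valP.
Qed.

Lemma restrict_ext A (g : 'cV[R[i]]_#|A|) : restrict A (ext g) = g.
Proof. by apply/colP => i; rewrite mxE ext_enum_val. Qed.

Lemma restrictP A w w' :
  restrict A w = restrict A w' <-> {in A, w =1 w'}.
Proof.
split=> [/colP ww' x xA|ww'].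
  by have := ww' (enum_rank_in xA x); rewrite !mxE enum_rankK_in.
by apply/colP => i; rewrite !mxE ww' // enum_valP.
Qed.

Lemma ext_restrict A w x : x \in A -> ext (restrict A w) x = w x.
Proof. by move: x; apply/restrictP; rewrite restrict_ext. Qed.

Lemma restrictD A u w :
  restrict A (fun x => u x + w x) = restrict A u + restrict A w.
Proof. by apply/colP => i; rewrite !mxE. Qed.

Lemma restrictN A u : restrict A (fun x => - u x) = - restrict A u.
Proof. by apply/colP => i; rewrite !mxE. Qed.

Lemma restrict_ext_disjoint A B (g : 'cV[R[i]]_#|B|) :
  [disjoint A & B] -> restrict A (ext g) = 0.
Proof.
move=> AB; apply/colP => i; rewrite !mxE ext_out //.
by rewrite (disjointFr AB) // enum_valP.
Qed.

Lemma act_entry A B (M : 'M[R[i]]_(#|A|, #|B|)) w x :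
  act (entry M) w x = ext (M *m restrict B w) x.
Proof.
rewrite /act /entry /ext.
under eq_bigr do rewrite mulr_suml.
rewrite exchange_big; apply: eq_bigr => i _; rewrite mxE.
under eq_bigr do rewrite mulr_suml big_mkcond.
rewrite exchange_big; apply: eq_bigr => j _; rewrite mxE -big_mkcond.
by rewrite (big_pred1 (enum_val j)) // => y; rewrite eq_sym.
Qed.

Lemma act_entryM A B D (M : 'M[R[i]]_(#|A|, #|B|))
    (N : 'M[R[i]]_(#|B|, #|D|)) w x :
  act (entry (M *m N)) w x = act (entry M) (act (entry N) w) x.
Proof.
rewrite !act_entry -mulmxA; congr (ext (_ *m _) x).
by apply/colP => i; rewrite [RHS]mxE act_entry ext_enum_val.
Qed.

Lemma eq_act K u w : u =1 w -> act K u =1 act K w.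
Proof. by move=> uw x; apply: eq_bigr => y _; rewrite uw. Qed.

Lemma actD K u w x : act K (fun y => u y + w y) x = act K u x + act K w x.
Proof. by rewrite /act -big_split; apply: eq_bigr => y _; rewrite mulrDr. Qed.

Lemma actN K u x : act K (fun y => - u y) x = - act K u x.
Proof. by rewrite /act -sumrN; apply: eq_bigr => y _; rewrite mulrN. Qed.

Variable a : X -> X -> R.

Lemma eq_laplacian u w : u =1 w -> laplacian a u =1 laplacian a w.
Proof. by move=> uw x; rewrite /laplacian uw (eq_act _ uw). Qed.

Lemma laplacianD u w x :
  laplacian a (fun y => u y + w y) x = laplacian a u x + laplacian a w x.
Proof. by rewrite /laplacian actD opprD addrACA. Qed.

Lemma laplacianN u x : laplacian a (fun y => - u y) x = - laplacian a u x.
Proof. by rewrite /laplacian actN opprD. Qed.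

Lemma restrict_act_ext A B (g : 'cV[R[i]]_#|B|) :
  restrict A (act (prob a) (ext g)) = Pmx a A B *m g.
Proof.
apply/colP => i; rewrite !mxE /act /ext.
under eq_bigr do rewrite mulr_sumr big_mkcond.
rewrite exchange_big; apply: eq_bigr => j _; rewrite mxE -big_mkcond.
by rewrite (big_pred1 (enum_val j)) // => y; rewrite eq_sym.
Qed.

Lemma restrict_laplacian_ext A B (g : 'cV[R[i]]_#|B|) :
  restrict A (laplacian a (ext g)) = Pmx a A B *m g - restrict A (ext g).
Proof. by rewrite -restrict_act_ext -restrictN -restrictD. Qed.

End Operators.

(** * Dirichlet problems and Green matrices *)

Section StronglyConnected.
Variables (R : realType) (X : finType) (E : rel X) (a : X -> X -> R).
Hypotheses (cardX : (2 <= #|X|)%N) (strong : forall x y : X, connect E x y)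
  (a_pos : forall x y : X, E x y -> 0 < a x y)
  (a_zero : forall x y : X, ~~ E x y -> a x y = 0).
Implicit Types (A : {set X}) (u w : X -> R[i]).

Lemma weight_ge0 x y : 0 <= a x y.
Proof. by have [/a_pos/ltW|/a_zero->] := boolP (E x y). Qed.

(** Strong connectedness with a second vertex gives every vertex an
out-neighbour. *)
Lemma mass_gt0 x : 0 < mass a x.
Proof.
have [y yx] : exists y, y != x.
  have := cardX; rewrite (cardD1 x) inE add1n ltnS => /card_gt0P[y].
  by rewrite !inE andbT; exists y.
have [s] := connectP (strong x y).
case: s => [_ yE|w s /= /andP[xw _] _]; first by rewrite yE eqxx in yx.
rewrite /mass (bigD1 w) //= ltr_pwDl ?a_pos // sumr_ge0 // => t _.
exact: weight_ge0.
Qed.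

Lemma prob_ge0 x y : 0 <= prob a x y.
Proof. by rewrite /prob ler0c divr_ge0 ?weight_ge0 // ltW ?mass_gt0. Qed.

Lemma prob_gt0 x y : E x y -> 0 < prob a x y.
Proof. by move=> xy; rewrite /prob ltcR divr_gt0 ?a_pos ?mass_gt0. Qed.

Lemma prob_sum x : \sum_y prob a x y = 1.
Proof.
rewrite /prob -rmorph_sum -mulr_suml -/(mass a x) divff ?rmorph1 //.
by rewrite gt_eqF ?mass_gt0.
Qed.

Lemma laplacian_const c x : laplacian a (fun=> c) x = 0.
Proof. by rewrite /laplacian /act -mulr_suml prob_sum mul1r subrr. Qed.

(** The difference of u and w is harmonic on A and vanishes off A. The vertex z
only witnesses that A is not the whole of X. *)
Lemma dirichlet_unique A z u w : z \notin A ->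
    {in A, laplacian a u =1 laplacian a w} -> {in ~: A, u =1 w} -> u =1 w.
Proof.
move=> zA lap_eq out_eq x; apply/eqP; rewrite -subr_eq0; apply/eqP.
pose v y := u y - w y; rewrite -/(v x).
apply: (harmonic_eq0 (A := A) strong prob_ge0 prob_gt0 prob_sum zA) => y yA.
  apply/esym/eqP; rewrite -subr_eq0 -/(act (prob a) v y) -/(laplacian a v y).
  by rewrite /v laplacianD laplacianN lap_eq // subrr.
by rewrite /v out_eq ?subrr // inE.
Qed.

(** A kernel vector of I - P_A, extended by zero, solves the homogeneous
Dirichlet problem on A, so it vanishes by uniqueness. *)
Lemma unitmx_green A z : z \notin A -> 1%:M - Pmx a A A \in unitmx.
Proof.
move=> zA; rewrite -unitmx_tr -row_free_unit.
apply: inj_row_free => v /(congr1 trmx); rewrite trmx_mul !trmxK trmx0.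
move=> Pv; apply: trmx_inj; rewrite trmx0 -[LHS]restrict_ext.
have -> : 0 = restrict A (fun=> 0 : R[i]) by apply/colP => i; rewrite !mxE.
apply/restrictP => x xA; apply: (dirichlet_unique zA) => [y|y].
  move: y; apply/restrictP; rewrite restrict_laplacian_ext restrict_ext.
  apply/colP => i; rewrite [RHS]mxE laplacian_const.
  by rewrite -opprB -[X in X - _]mul1mx -mulmxBl Pv oppr0 mxE.
by rewrite inE => yA; rewrite ext_out.
Qed.

(** Applied to a function supported in A, the Laplacian restricted to A is the
matrix P_A - I_A, which is minus the inverse of the Green matrix. *)
Lemma laplacian_green A z w x : z \notin A -> x \in A ->
  laplacian a (act (entry (green a A)) w) x = - w x.
Proof.
move=> zA; move: x; apply/restrictP.
rewrite restrictN -[in RHS](mul1mx (restrict A w)).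
rewrite -(mulmxV (unitmx_green zA)) -mulmxA -mulNmx opprB mulmxBl mul1mx.
rewrite -{2}[invmx _ *m _]restrict_ext -restrict_laplacian_ext.
by apply/restrictP => x _; apply: eq_laplacian => y; rewrite act_entry.
Qed.

(** * The plate problem *)

Section Boundary.
Variables (dX : {set X}).
Hypothesis (dX_nonempty : dX != set0).
Local Notation Xo := (~: dX).
Local Notation G := (green a Xo).
Implicit Types (g : 'cV[R[i]]_#|dX|).

Lemma act_green_out A w x : x \notin A -> act (entry (green a A)) w x = 0.
Proof. by move=> xA; rewrite act_entry ext_out. Qed.

(** The integral against the harmonic measures as the extension of g by zero
plus a correction supported in the interior. *)
Lemma boundary_intE g x :
  boundary_int a g x = ext g x + ext (G *m Pmx a Xo dX *m g) x.
Proof.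
rewrite /boundary_int /nu; have [xd|xd] := boolP (x \in dX).
  rewrite (ext_out _ (A := Xo)) ?inE ?xd // addr0 (bigD1 x) //= eqxx mulr1.
  by rewrite big1 ?addr0 // => y /andP[_ /negPf yx]; rewrite eq_sym yx mulr0.
rewrite ext_out // add0r -{2}(restrict_ext g) -act_entry /act.
rewrite [RHS](bigID [in dX]) /= [X in _ + X]big1 ?addr0.
  by apply: eq_bigr => y _; rewrite mulrC.
by move=> y yd; rewrite [ext _ _]ext_out // mulr0.
Qed.

Lemma boundary_int_in g x : x \in dX -> boundary_int a g x = ext g x.
Proof.
by move=> xd; rewrite boundary_intE (ext_out _ (A := Xo)) ?inE ?xd // addr0.
Qed.

Lemma restrict_boundary_int g :
  restrict Xo (boundary_int a g) = G *m Pmx a Xo dX *m g.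
Proof.
rewrite -[RHS]restrict_ext; apply/restrictP => x; rewrite inE => xd.
by rewrite boundary_intE ext_out // add0r.
Qed.

Lemma interior_proper : exists2 z, z \in dX & z \notin Xo.
Proof. by have [z zd] := set0Pn _ dX_nonempty; exists z; rewrite ?inE ?zd. Qed.

(** The interior correction of [boundary_intE] is G applied to P (ext g), and
P (ext g) is the Laplacian of ext g in the interior, where ext g is zero; the
two Laplacians cancel. *)
Lemma laplacian_boundary_int g x :
  x \in Xo -> laplacian a (boundary_int a g) x = 0.
Proof.
move=> xo; have [z _ zo] := interior_proper.
have -> : laplacian a (boundary_int a g) x
    = laplacian a (fun y => ext g y
        + act (entry G) (act (prob a) (ext g)) y) x.
  apply: eq_laplacian => y.
  by rewrite boundary_intE act_entry restrict_act_ext mulmxA.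
rewrite laplacianD (laplacian_green _ zo xo) /laplacian ext_out ?subr0 ?subrr //.
by move: xo; rewrite inE.
Qed.

Variables (f : 'cV[R[i]]_#|Xo|) (g1 g2 : 'cV[R[i]]_#|dX|).

(** The function forced to equal minus the Laplacian of any solution. *)
Definition defect x : R[i] := act (entry G) (ext f) x + boundary_int a g1 x.

Lemma defect_boundary x : x \in dX -> defect x = ext g1 x.
Proof.
by move=> xd; rewrite /defect act_green_out ?inE ?xd // add0r boundary_int_in.
Qed.

(** Order reduction: the Laplacian of a solution and - defect solve the same
Dirichlet problem in the interior, hence agree on all of X. *)
Lemma plate_solution_poisson u :
  plate_solution a f g1 g2 u <->
  (forall x, laplacian a u x = - defect x) /\ {in dX, u =1 ext g2}.
Proof.
have [z _ zo] := interior_proper.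
have lap_defect x : x \in Xo -> laplacian a (fun y => - defect y) x = ext f x.
  move=> xo; rewrite laplacianN /defect laplacianD.
  by rewrite (laplacian_green _ zo xo) laplacian_boundary_int // addr0 opprK.
split=> [[bih nder dir]|[pois dir]].
  split=> //; apply: (dirichlet_unique zo) => x.
    by move=> xo; rewrite bih // lap_defect.
  rewrite setCK => xd; rewrite -[LHS]opprK.
  by rewrite -/(normal_deriv a u x) nder // defect_boundary.
split=> // x xX; first by rewrite (eq_laplacian a pois) lap_defect.
by rewrite /normal_deriv pois opprK defect_boundary.
Qed.

Definition plate_formula x : R[i] :=
  act (entry (G ^+ 2)) (ext f) x + act (entry G) (boundary_int a g1) x
  + boundary_int a g2 x.

Lemma plate_formulaE x :
  plate_formula x = act (entry G) defect x + boundary_int a g2 x.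
Proof.
rewrite /plate_formula expr2 act_entryM; congr (_ + _).
by rewrite -actD.
Qed.

Lemma plate_formula_boundary x : x \in dX -> plate_formula x = ext g2 x.
Proof.
move=> xd; rewrite plate_formulaE boundary_int_in // act_green_out ?add0r //.
by rewrite inE xd.
Qed.

Lemma laplacian_plate_formula x :
  x \in Xo -> laplacian a plate_formula x = - defect x.
Proof.
move=> xo; have [z _ zo] := interior_proper.
rewrite (eq_laplacian a plate_formulaE) laplacianD (laplacian_green _ zo xo).
by rewrite laplacian_boundary_int // addr0.
Qed.

(** In block form: the formula splits into g2 on the boundary and k in the
interior, and the rows of P - I indexed by the boundary are applied to both. *)
Lemma restrict_laplacian_plate_formula :
  restrict dX (laplacian a plate_formula)
  = boundary_laplacian a dX *m g2 + Pmx a dX Xo *m G ^+ 2 *m f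
    + boundaryR a dX *m g1.
Proof.
pose k := G ^+ 2 *m f + G *m (G *m Pmx a Xo dX *m g1) + G *m Pmx a Xo dX *m g2.
have formulaE : plate_formula =1 (fun x => ext g2 x + ext k x).
  move=> x; rewrite /plate_formula !act_entry restrict_ext restrict_boundary_int.
  rewrite boundary_intE addrCA; congr (_ + _).
  by rewrite /k /ext -!big_split; apply: eq_bigr => i _; rewrite !mxE.
have -> : restrict dX (laplacian a plate_formula)
    = restrict dX (laplacian a (ext g2)) + restrict dX (laplacian a (ext k)).
  rewrite -restrictD; apply/restrictP => x _.
  by rewrite (eq_laplacian a formulaE) laplacianD.
rewrite !restrict_laplacian_ext restrict_ext restrict_ext_disjoint ?subr0.
  rewrite /boundary_laplacian /boundaryQ /boundaryR /k expr2 -mulmxE.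
  rewrite !mulmxDr !mulmxBl !mulmxDl mul1mx !mulmxA -!addrA; congr (_ + _).
  by rewrite [RHS]addrCA; congr (_ + _); rewrite [RHS]addrC addrA.
by rewrite -subsets_disjoint.
Qed.

Definition compatible : Prop :=
  boundary_laplacian a dX *m g2 + Pmx a dX Xo *m G ^+ 2 *m f
  = - ((1%:M + boundaryR a dX) *m g1).

(** The compatibility condition is the part of the Poisson equation of
[plate_solution_poisson] that lives on the boundary. *)
Lemma compatibleP :
  compatible <-> {in dX, laplacian a plate_formula =1 (fun x => - defect x)}.
Proof.
rewrite -restrictP restrict_laplacian_plate_formula restrictN.
have -> : restrict dX defect = g1.
  by rewrite -[RHS]restrict_ext; apply/restrictP => x; apply: defect_boundary.
rewrite /compatible mulmxDl mul1mx opprD; split=> [->|<-].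
  by rewrite subrK.
by rewrite addrK.
Qed.

(** The interior part of the Poisson equation, with the boundary values,
determines u; the boundary part is then the compatibility condition. *)
Lemma plate_solutionP u :
  plate_solution a f g1 g2 u <-> compatible /\ u =1 plate_formula.
Proof.
rewrite plate_solution_poisson compatibleP.
split=> [[pois dir]|[compat uE]].
  have [z _ zo] := interior_proper.
  have uE : u =1 plate_formula.
    apply: (dirichlet_unique zo) => x.
      by move=> xo; rewrite pois laplacian_plate_formula.
    by rewrite setCK => xd; rewrite dir // plate_formula_boundary.
  by split=> // x _; rewrite -(eq_laplacian a uE).
split=> x; last by move=> xd; rewrite uE plate_formula_boundary.
rewrite (eq_laplacian a uE); have [xd|xd] := boolP (x \in dX).
  exact: compat.
by rewrite laplacian_plate_formula // inE.
Qed.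

(** The Poisson equation of [plate_solution_poisson] holds on the boundary as
well, so it can be solved on the complement of a single boundary vertex z. The
constant g2 z carries the value at z and has zero Laplacian. *)
Lemma plate_solution_pinned z u : z \in dX -> plate_solution a f g1 g2 u ->
  u =1 (fun x => act (entry (green a [set~ z])) defect x + ext g2 z).
Proof.
rewrite plate_solution_poisson => zd [pois dir].
have zz : z \notin [set~ z] by rewrite !inE eqxx.
apply: (dirichlet_unique zz) => x xz.
  by rewrite pois laplacianD laplacian_const addr0 (laplacian_green _ zz xz).
move: xz; rewrite setCK inE => /eqP ->.
by rewrite dir // act_green_out // add0r.
Qed.

End Boundary.
End StronglyConnected.

Theorem mainTheorem8 (R : realType) (X : finType) (E : rel X) (a : X -> X -> R)
    (cardX : (2 <= #|X|)%N)
    (noloop : irreflexive E)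
    (strong : forall x y : X, connect E x y)
    (a_pos : forall x y : X, E x y -> 0 < a x y)
    (a_zero : forall x y : X, ~~ E x y -> a x y = 0)
    (dX : {set X}) (dX_nonempty : dX != set0)
    (f : 'cV[R[i]]_#|~: dX|) (g1 g2 : 'cV[R[i]]_#|dX|) :
  let Xo := ~: dX in
  let h1 := boundary_int a g1 in
  let h2 := boundary_int a g2 in
  let compatible :=
    boundary_laplacian a dX *m g2 + Pmx a dX Xo *m green a Xo ^+ 2 *m f
    = - ((1%:M + boundaryR a dX) *m g1) in
  [/\ (exists u : X -> R[i], plate_solution a f g1 g2 u) <-> compatible,
      compatible -> forall u : X -> R[i],
        plate_solution a f g1 g2 u <->
        (forall x : X,
           u x = act (entry (green a Xo ^+ 2)) (ext f) x
                 + act (entry (green a Xo)) h1 x + h2 x)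
    & compatible -> forall z : X, z \in dX -> forall u : X -> R[i],
        plate_solution a f g1 g2 u <->
        (forall x : X,
           u x = act (entry (green a [set~ z]))
                     (act (entry (green a Xo)) (ext f)) x
                 + act (entry (green a [set~ z])) h1 x + ext g2 z)].
Proof.
move=> Xo h1 h2 compat.
have solP := plate_solutionP cardX strong a_pos a_zero dX_nonempty f g1 g2.
split.
- split=> [[u /solP[]]//|c]; exists (plate_formula a f g1 g2).
  by apply/solP; split.
- by move=> c u; split=> [/solP[_ uE]|uE]; [exact: uE | apply/solP; split].
- move=> c z zd u.
  have pinned w : plate_solution a f g1 g2 w -> forall x,
      w x = act (entry (green a [set~ z]))
                (act (entry (green a Xo)) (ext f)) x
            + act (entry (green a [set~ z])) h1 x + ext g2 z.
    move=> sol x; rewrite -actD.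
    exact: (plate_solution_pinned cardX strong a_pos a_zero dX_nonempty zd sol).
  split=> [|uE]; first exact: pinned.
  (* Under compatibility a solution exists, and it satisfies the pinned formula
     too, so the formula holds for no other function. *)
  apply/solP; split=> // x; rewrite uE -(pinned (plate_formula a f g1 g2)) //.
  by apply/solP; split.
Qed.
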